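(* Let $k>0$, let $B=\{x\in\mathbb{R}^2:|x|\le 1\}$, and let $\mathcal{F}:L^\infty(B)\to L^2(B)$ be the unknown-to-data operator at wavenumber $k$, which maps a contrast $q$ to its processed far-field data (as defined in the context). For every $\phi\in[0,2\pi]$, with $R_\phi=\begin{bmatrix}\cos\phi&-\sin\phi\\ \sin\phi&\cos\phi\end{bmatrix}$ and with $R_\phi f$ denoting the rotated function $(R_\phi f)(x)=f(R_{-\phi}x)$, $x\in B$, one has $$\mathcal{F}(R_\phi q)=R_\phi(\mathcal{F}q)$$ for all $q\in L^\infty(B)$, where the equality is in $L^2(B)$, i.e. $[\mathcal{F}(R_\phi q)](p)=[\mathcal{F}q](R_{-\phi}p)$ for almost every $p\in B$.
   Context: Notation: $\mathbb{S}=\{x\in\mathbb{R}^2:|x|=1\}$; $B$ is the unit disk; $k>0$ is a fixed wavenumber; $i$ is the imaginary unit. Direct scattering problem. A contrast $q\in L^\infty(B)$ is extended by zero to $\mathbb{R}^2$. For an incident direction $\hat\theta\in\mathbb{S}$, the incident plane wave is $u^i(x)=e^{ik\hat\theta\cdot x}$. The scattered field $u^s=u^s(\cdot;\hat\theta;k;q)\in H^1_{loc}(\mathbb{R}^2)$ is the solution of $$\Delta u^s+k^2(1+q)u^s=-k^2q\,u^i\quad\text{in }\mathbb{R}^2,$$ $$\lim_{|x|\to\infty}|x|^{1/2}\left(\nabla u^s\cdot\frac{x}{|x|}-iku^s\right)=0$$ (Sommerfeld radiation condition). Standing assumption: for the contrasts $q$ under consideration this problem has exactly one solution for every $\hat\theta\in\mathbb{S}$,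 so that $u^s$ and the data below are well defined. Far-field pattern. As $|x|\to\infty$, with $\hat x=x/|x|\in\mathbb{S}$ the observation direction, $$u^s(x)=\frac{e^{i\pi/4}}{\sqrt{8k\pi}}\frac{e^{ik|x|}}{\sqrt{|x|}}\left(u^\infty(\hat x;\hat\theta;k)+\mathcal{O}(|x|^{-1})\right),$$ which defines the far-field pattern $u^\infty(\hat x;\hat\theta;k)$. It has the integral representation $$u^\infty(\hat x;\hat\theta;k)=k^2\int_{B}e^{-ik\hat x\cdot y}\left(u^s(y)+e^{ik\hat\theta\cdot y}\right)q(y)\,dy.$$ Processed data and the operator $\mathcal{F}$. Known fact (reciprocity relation): $u^\infty(\hat x;\hat\theta;k)=u^\infty(-\hat\theta;-\hat x;k)$ for all $\hat x,\hat\theta\in\mathbb{S}$. For almost every $p\in B$ (all $p$ with $0<|p|<1$) there are exactly two pairs $(\hat x,\hat\theta)\in\mathbb{S}\times\mathbb{S}$ with $p=\frac{\hat\theta-\hat x}{2}$; if one is $(\hat x_1,\hat\theta_1)$, the other is $(-\hat\theta_1,-\hat x_1)$. By reciprocity the following is therefore well defined for almost every $p\in B$: with $c=2k$, $$u(p;c)=\frac{1}{k^2}u^\infty(\hat x;\hat\theta;k),\qquad p\neq 0,\quad\text{where } p=\frac{\hat\theta-\hat x}{2}\text{ for some }(\hat\theta,\hat x)\in\mathbb{S}\times\mathbb{S}.$$ The unknown-to-data operator $\mathcal{F}:L^\infty(B)\to L^2(B)$ is $\mathcal{F}q:=u(\cdot;c)$, where $u$ is obtained from the far-field patterns of the contrast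 $q$. *)

(* Defs.v *)
From HB Require Import structures.
From mathcomp Require Import all_boot all_order all_algebra.
From mathcomp Require Import all_classical all_reals all_analysis.
From mathcomp Require Import complex.
Import Order.TTheory GRing.Theory Num.Theory.
Import numFieldNormedType.Exports.

Set Implicit Arguments.
Unset Strict Implicit.
Unset Printing Implicit Defensive.

Local Open Scope classical_set_scope.
Local Open Scope ring_scope.
Local Open Scope complex_scope.

Notation plane R := (R * R)%type.

Notation lebesgue2 R := (@lebesgue_measure R \x @lebesgue_measure R)%E.

Section Scattering.
Variable R : realType.
Implicit Types (k phi r : R) (x v p theta xhat : plane R).
Implicit Types (f g q u us : plane R -> R[i]) (psi : plane R -> R).

(* The norm that mathcomp-analysis puts on [R * R] is the maximum norm, hence
   the explicit Euclidean one. *)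
Definition enorm x : R := Num.sqrt (x.1 ^+ 2 + x.2 ^+ 2).
Definition dot x v : R := x.1 * v.1 + x.2 * v.2.
Definition unit_vec x : plane R := (x.1 / enorm x, x.2 / enorm x).
Definition e1 : plane R := (1, 0).
Definition e2 : plane R := (0, 1).

Definition circle : set (plane R) := [set x | enorm x = 1].
Definition cdisk r : set (plane R) := [set x | enorm x <= r].
Definition unit_disk : set (plane R) := cdisk 1.

Definition rotation phi x : plane R :=
  (cos phi * x.1 - sin phi * x.2, sin phi * x.1 + cos phi * x.2).

Definition rotf (T : Type) phi (f : plane R -> T) : plane R -> T :=
  fun x => f (rotation (- phi) x).

Definition near_infinity (P : plane R -> Prop) : Prop :=
  exists r, forall x, r < enorm x -> P x.

Definition normc (z : R[i]) : R := ComplexField.Normc.normc z.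

(* [cis t] is $e^{it}$. *)
Definition cis (t : R) : R[i] := cos t +i* sin t.

Definition cint f : R[i] :=
  Rintegral (lebesgue2 R) setT (fun x => complex.Re (f x)) +i*
  Rintegral (lebesgue2 R) setT (fun x => complex.Im (f x)).

(* Membership of (a representative) [f] in $L^p(D)$. *)
Definition cLp (p : \bar R) (D : set (plane R)) f : Prop :=
  [/\ measurable_fun D (fun x => complex.Re (f x)),
      measurable_fun D (fun x => complex.Im (f x)) &
      ('N[lebesgue2 R]_p [EFin \o patch (fun=> 0%R) D (normc \o f)] < +oo)%E].

Definition L2loc f : Prop := forall r, cLp 2%:E (cdisk r) f.

Fixpoint Cn (n : nat) psi : Prop :=
  if n is m.+1 then
    (forall x, differentiable psi x) /\ (forall v, Cn m (fun x => 'D_v psi x))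
  else continuous psi.

(* Real-valued test functions determine the same distributional identities as
   complex-valued ones, by linearity. *)
Definition test_function psi : Prop :=
  (forall n, Cn n psi) /\ (exists r, forall x, r < enorm x -> psi x = 0).

Definition laplacian psi x : R :=
  'D_e1 (fun y => 'D_e1 psi y) x + 'D_e2 (fun y => 'D_e2 psi y) x.

Definition weak_derivative v u g : Prop :=
  forall psi, test_function psi ->
    cint (fun x => u x * ('D_v psi x)%:C) = - cint (fun x => g x * (psi x)%:C).

Definition H1loc u : Prop :=
  [/\ L2loc u,
      exists2 g, L2loc g & weak_derivative e1 u g &
      exists2 g, L2loc g & weak_derivative e2 u g].

Definition cdifferentiable u x : Prop :=
  differentiable (fun y => complex.Re (u y)) x /\
  differentiable (fun y => complex.Im (u y)) x.

Definition cderive v u x : R[i] :=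
  'D_v (fun y => complex.Re (u y)) x +i* 'D_v (fun y => complex.Im (u y)) x.

(* The condition involves pointwise values of the gradient, so it selects a
   representative of the $H^1_{loc}$ class that is differentiable near
   infinity; solutions of the equation have one by elliptic regularity, since
   the contrast has compact support. *)
Definition sommerfeld k us : Prop :=
  near_infinity (cdifferentiable us) /\
  forall eps : R, 0 < eps -> near_infinity (fun x =>
    normc ((Num.sqrt (enorm x))%:C *
           (cderive e1 us x * (unit_vec x).1%:C +
            cderive e2 us x * (unit_vec x).2%:C -
            (0 +i* k) * us x)) < eps).

Definition plane_wave k theta x : R[i] := cis (k * dot theta x).

Definition extend0 q : plane R -> R[i] := patch (fun=> 0) unit_disk q.

Definition helmholtz k q theta us : Prop :=
  forall psi, test_function psi ->
    cint (fun x => us x * (laplacian psi x)%:C) +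
    (k ^+ 2)%:C * cint (fun x => (1 + extend0 q x) * us x * (psi x)%:C) =
    - (k ^+ 2)%:C *
      cint (fun x => extend0 q x * plane_wave k theta x * (psi x)%:C).

Definition is_scattered_field k q theta us : Prop :=
  [/\ H1loc us, helmholtz k q theta us & sommerfeld k us].

Definition well_posed k q : Prop :=
  forall theta, circle theta -> exists us, is_scattered_field k q theta us /\
    forall us', is_scattered_field k q theta us' ->
      {ae lebesgue2 R, forall x, us' x = us x}.

Definition scattered_field k q theta : plane R -> R[i] :=
  xget (fun=> 0) [set us | is_scattered_field k q theta us].

Definition far_factor k r : R[i] :=
  cis (pi / 4) / (Num.sqrt (8 * k * pi))%:C * (cis (k * r) / (Num.sqrt r)%:C).

(* Only the values of [f] on [circle] matter; they are determined by [us]. *)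
Definition is_far_field k us f : Prop :=
  exists c : R, near_infinity (fun x => exists rem : R[i],
    us x = far_factor k (enorm x) * (f (unit_vec x) + rem) /\
    normc rem <= c / enorm x).

Definition far_field k q xhat theta : R[i] :=
  xget (fun=> 0)
    [set f | is_far_field k (scattered_field k q theta) f] xhat.

(* For [0 < enorm p < 1] there are two admissible pairs [(xhat, theta)], which
   give the same value by reciprocity. The values at [p = 0] and for
   [1 < enorm p] are irrelevant. *)
Definition data_operator k q p : R[i] :=
  xget 0 [set w | p <> 0 /\ exists xhat theta,
    [/\ circle xhat, circle theta, p = 2^-1 *: (theta - xhat) &
        w = (k ^- 2)%:C * far_field k q xhat theta]].

End Scattering.

(* Main.v *)
Require Import Defs.
From HB Require Import structures.
From mathcomp Require Import all_boot all_order all_algebra.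
From mathcomp Require Import all_classical all_reals all_analysis.
From mathcomp Require Import measurable_realfun complex ring lra.
Import Order.TTheory GRing.Theory Num.Theory.
Import numFieldNormedType.Exports.
Local Open Scope classical_set_scope.
Local Open Scope ring_scope.

(** Every ingredient of the scattering problem commutes with a rotation [R] of
    the plane: Lebesgue measure is invariant, derivatives satisfy
    [D_v (f o R) = (D_(R v) f) o R], the Laplacian is invariant, and so is the
    radial derivative of the radiation condition. Hence [us o R] solves the
    problem for the contrast [q o R] and the direction [theta] as soon as [us]
    solves it for [q] and [R theta]. Well-posedness identifies the two fields
    almost everywhere, hence, by continuity, everywhere near infinity, where
    the far field is read off. Since [R] maps the pairs [(xhat, theta)]
    admissible for [p] bijectively onto those admissible for [R p], both data
    operators select a value from one and the same set. *)

Set Implicit Arguments.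
Unset Strict Implicit.
Unset Printing Implicit Defensive.

(** * Change of variables under measure-preserving bijections *)

Section MeasurePreserving.
Context d (T : measurableType d) (R : realType).
Variable mu : {measure set T -> \bar R}.
Implicit Types f g : T -> T.

Definition measure_preserving f : Prop :=
  measurable_fun setT f /\
  forall A, measurable A -> mu (f @^-1` A) = mu A.

Lemma measure_preserving_comp f g :
  measure_preserving f -> measure_preserving g -> measure_preserving (f \o g).
Proof.
move=> [mf ef] [mg eg]; split; first exact: measurableT_comp.
move=> A mA; rewrite comp_preimage eg ?ef//.
by rewrite -[X in measurable X]setTI; exact: mf.
Qed.

Import HBNNSimple.

(** This is the supremum behind [integral]. Arguing on it directly gives a change of variables for
    every integrand, measurable or not, as [cint] requires. *)
Let nnintegral (h : T -> \bar R) : \bar R :=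
  ereal_sup [set sintegral mu s |
    s in [set s : {nnsfun T >-> R} | forall x, ((s x)%:E <= h x)%E]].

(** A simple function [s] below [h] pulls back to the simple function [s \o f] below [h \o f], and
    the integral is unchanged because [f] preserves the measure of the level sets of [s]. *)
Let nnintegral_comp_le f (h : T -> \bar R) : measure_preserving f ->
  (nnintegral h <= nnintegral (h \o f))%E.
Proof.
move=> [mf ef]; apply: ge_ereal_sup => _ [s sh <-].
have ms : measurable_fun setT (s \o f) by apply: measurableT_comp.
have fs : finite_set (range (s \o f)).
  apply: (@sub_finite_set _ _ (range s)); last exact: fimfunP.
  by move=> _ [x _ <-]; exists (f x).
have s0 x : 0 <= (s \o f) x by rewrite /= fun_ge0.
pose mM := isMeasurableFun.Build _ _ _ _ _ ms.
pose fM := FiniteImage.Build _ _ _ fs.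
pose nM := isNonNegFun.Build _ _ _ s0.
pose t : {nnsfun T >-> R} := HB.pack (s \o f) mM fM nM.
apply: ereal_sup_ubound => /=; exists t; first by move=> x; exact: sh.
(* Summing over all reals gives both sums the same index set, so they match term by term even if
   [s \o f] takes fewer values than [s]. *)
rewrite !sintegralET; apply: eq_fsbigr => r _.
rewrite /= comp_preimage ef//.
Qed.

(* The integral of a nonnegative function is the supremum of the integrals of
   the simple functions below it, and composition with [f] permutes these. *)
Lemma integral_measure_preserving f g (h : T -> \bar R) :
  measure_preserving f -> measurable_fun setT g -> cancel f g -> cancel g f ->
  (\int[mu]_x h (f x) = \int[mu]_x h x)%E.
Proof.
move=> pf mg fK gK.
have pg : measure_preserving g.
  split=> // A mA; have mgA : measurable (g @^-1` A).
    by rewrite -[X in measurable X]setTI; exact: mg.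
  rewrite -(proj2 pf _ mgA); congr (mu _).
  by apply/funext => x; rewrite /preimage /= fK.
have nnE k : nnintegral (k \o f) = nnintegral k.
  apply/eqP; rewrite eq_le nnintegral_comp_le// andbT.
  have kE : k = (k \o f) \o g by apply/funext => x /=; rewrite gK.
  by rewrite {2}kE; exact: nnintegral_comp_le.
rewrite /integral !patch_setT.
congr (_ - _)%E.
- rewrite -[RHS](nnE h^\+%E) (_ : (fun x => h (f x))^\+%E = h^\+%E \o f)//.
  by apply/funext => x; rewrite /= !funeposE.
- rewrite -[RHS](nnE h^\-%E) (_ : (fun x => h (f x))^\-%E = h^\-%E \o f)//.
  by apply/funext => x; rewrite /= !funenegE.
Qed.

End MeasurePreserving.

(** * Rotation invariance of planar Lebesgue measure *)

(* [lebesgue2] lives on the structure [measurableTypeR], whereas [cLp] uses the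
   default measurable structure of [R]: the two have convertible measurable
   sets but different displays, hence the mixed annotations below. *)
Section PlaneMeasure.
Variable R : realType.
Local Notation mR := (measurableTypeR R).
Local Notation mu1 := (@lebesgue_measure R).
Local Notation mu2 := (lebesgue2 R).

(** The pushforward by the translation agrees with Lebesgue measure on the intervals []a, b]], and
    these determine the measure. *)
Lemma lebesgue_measure_shift (c : R) (A : set mR) : measurable A ->
  mu1 ((fun y => y + c) @^-1` A) = mu1 A.
Proof.
move=> mA.
have mf : measurable_fun setT (fun y : mR => y + c : mR).
  have h : measurable_fun setT (fun y : R => y + c : R).
    by apply: measurable_funD.
  exact: h.
pose nu : {measure set mR -> \bar R} :=
  measure_function_pushforward__canonical__measure_function_Measure mu1 mf.
apply/esym; apply: (@lebesgue_measure_unique R nu) => // _ [[a b]] _ <-.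
rewrite /nu /= /pushforward.
have -> : (fun y : mR => y + c) @^-1` `]a, b] = `]a - c, b - c]%classic.
  apply/seteqP; split => y /=; rewrite !in_itv /=; lra.
rewrite !lebesgue_measure_itv /= !lte_fin ltrD2r.
by case: ifP => // _; rewrite -!EFinB; congr EFin; lra.
Qed.

(** Shears serve as factors of rotations. They slide each line parallel to an axis along itself, so
    their invariance reduces to that of length under translations. *)
Definition shear1 (a : R) (x : plane R) : plane R := (x.1 + a * x.2, x.2).
Definition shear2 (a : R) (x : plane R) : plane R := (x.1, x.2 + a * x.1).

Lemma measurable_shear1 a :
  measurable_fun setT (shear1 a : mR * mR -> mR * mR).
Proof.
have h : measurable_fun setT (shear1 a : R * R -> R * R).
  apply: measurable_fun_pair => //=.
  apply: measurable_funD => //; exact: measurable_funM.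
exact: h.
Qed.

Lemma measurable_shear2 a :
  measurable_fun setT (shear2 a : mR * mR -> mR * mR).
Proof.
have h : measurable_fun setT (shear2 a : R * R -> R * R).
  apply: measurable_fun_pair => //=.
  apply: measurable_funD => //; exact: measurable_funM.
exact: h.
Qed.

Lemma measure_preserving_shear2 a : measure_preserving mu2 (shear2 a).
Proof.
split; first exact: measurable_shear2.
move=> A mA; rewrite /product_measure1; apply: eq_integral => x _ /=.
rewrite -[RHS](lebesgue_measure_shift (a * x)); last exact: measurable_xsection.
by congr (mu1 _).
Qed.

(** For [shear1] the translated sections are those at fixed second coordinate, so the order of
    integration must be exchanged. The two product measures agree on rectangles, hence on all
    measurable sets. *)
Lemma lebesgue2_symmetric (A : set (mR * mR)) : measurable A ->
  mu2 A = (product_measure2 mu1 mu1) A.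
Proof.
move=> mA; apply: (product_measure_unique (m1 := mu1) (m2 := mu1)) => //.
by move=> B C mB mC; exact: product_measure2E.
Qed.

Lemma measure_preserving_shear1 a : measure_preserving mu2 (shear1 a).
Proof.
split; first exact: measurable_shear1.
move=> A mA.
have mfA : measurable (shear1 a @^-1` A).
  by rewrite -[X in measurable X]setTI; exact: measurable_shear1.
apply: etrans (lebesgue2_symmetric mfA) _.
apply: etrans (esym (lebesgue2_symmetric mA)).
apply: eq_integral => y _ /=.
rewrite -[RHS](lebesgue_measure_shift (a * y)); last exact: measurable_ysection.
by congr (mu1 _).
Qed.

Lemma rotationD phi psi (x : plane R) :
  rotation (phi + psi) x = rotation phi (rotation psi x).
Proof.
by rewrite /rotation cosD sinD; congr (_, _) => /=; ring.
Qed.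

Lemma rotation0 : @rotation R 0 = id.
Proof.
by apply/funext => -[x y]; rewrite /rotation cos0 sin0; congr (_, _) => /=; ring.
Qed.

Lemma rotationK phi : cancel (@rotation R phi) (rotation (- phi)).
Proof. by move=> x; rewrite -rotationD addNr rotation0. Qed.

Lemma rotationNK phi : cancel (@rotation R (- phi)) (rotation phi).
Proof. by move=> x; rewrite -rotationD addrN rotation0. Qed.

(** Classical three-shear factorisation; [cos (phi / 2)] is the denominator of the tangent. *)
Lemma rotation_shears phi : cos (phi / 2) != 0 ->
  @rotation R phi =
  shear1 (- tan (phi / 2)) \o shear2 (sin phi) \o shear1 (- tan (phi / 2)).
Proof.
move=> c0; apply/funext => -[x y]; rewrite /shear1 /shear2 /rotation /tan /=.
have -> : phi = phi / 2 + phi / 2 by lra.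
set h := phi / 2 in c0 *.
have -> : (h + h) / 2 = h by lra.
rewrite cosD sinD; set t := sin h / cos h.
have sE : sin h = t * cos h by rewrite /t mulfVK.
(* Once [sin h] is replaced by [t * cos h], this is the Pythagorean identity, modulo which [ring]
   checks both coordinates. *)
have cs : t ^+ 2 * cos h ^+ 2 = 1 - cos h ^+ 2.
  by rewrite -exprMn -sE -(cos2Dsin2 h); ring.
by rewrite !sE; congr (_, _); ring: cs.
Qed.

Lemma measure_preserving_rotation phi : measure_preserving mu2 (rotation phi).
Proof.
have main psi : cos (psi / 2) != 0 -> measure_preserving mu2 (rotation psi).
  move=> /rotation_shears ->.
  have m1 := measure_preserving_shear1 (- tan (psi / 2)).
  have m2 := measure_preserving_shear2 (sin psi).
  exact: (measure_preserving_comp (measure_preserving_comp m1 m2) m1).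
(* At odd multiples of [pi] the shears degenerate: rotate twice by half. *)
have [c0|] := eqVneq (cos (phi / 2)) 0; last exact: main.
have half : measure_preserving mu2 (rotation (phi / 2)).
  (* If the cosines of [phi / 2] and of its half both vanished, the addition formula would make the
     sine of that half vanish too. *)
  apply: main; apply/eqP => c1; have := cosD (phi / 2 / 2) (phi / 2 / 2).
  rewrite -splitr c0 c1 mul0r sub0r => /esym/eqP; rewrite oppr_eq0 mulf_eq0 orbb.
  have := cos2Dsin2 (phi / 2 / 2); rewrite c1 => cs /eqP s0; move: cs; rewrite s0; lra.
have -> : @rotation R phi = rotation (phi / 2) \o rotation (phi / 2).
  by apply/funext => x /=; rewrite -rotationD -splitr.
exact: measure_preserving_comp.
Qed.

Lemma integral_rotation phi (h : plane R -> \bar R) :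
  (\int[mu2]_x h (rotation phi x) = \int[mu2]_x h x)%E.
Proof.
exact: (@integral_measure_preserving _ _ _ mu2 _ _ h
  (measure_preserving_rotation phi)
  (proj1 (measure_preserving_rotation (- phi))) (rotationK phi) (rotationNK phi)).
Qed.

Lemma cint_rotation phi (f : plane R -> R[i]) :
  cint (fun x => f (rotation phi x)) = cint f.
Proof.
rewrite /cint /Rintegral.
by rewrite (integral_rotation phi (fun x => (complex.Re (f x))%:E))
  (integral_rotation phi (fun x => (complex.Im (f x))%:E)).
Qed.

End PlaneMeasure.

(** * Rotations and classical derivatives *)

Section PlaneDerivatives.
Variable R : realType.
Implicit Types (phi : R) (x v : plane R) (f psi : plane R -> R).

Lemma enorm_rotation phi x : enorm (rotation phi x) = enorm x.
Proof.
have cs := cos2sin2 phi.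
by rewrite /enorm /rotation /=; congr Num.sqrt; ring: cs.
Qed.

Lemma continuous_enorm : continuous (@enorm R).
Proof.
move=> x; apply: continuous_comp; last exact: sqrt_continuous.
by apply: cvgD; apply: cvgM; (exact: cvg_fst || exact: cvg_snd).
Qed.

Lemma dot_rotation phi x v : dot (rotation phi x) (rotation phi v) = dot x v.
Proof. by have cs := cos2sin2 phi; rewrite /dot /rotation /=; ring: cs. Qed.

Lemma rotation_scale phi (a : R) x : rotation phi (a *: x) = a *: rotation phi x.
Proof. by rewrite /rotation; congr (_, _); rewrite /= /GRing.scale /=; ring. Qed.

Lemma rotation_add phi x v : rotation phi (x + v) = rotation phi x + rotation phi v.
Proof. by rewrite /rotation; congr (_, _) => /=; ring. Qed.

Lemma rotation_opp phi x : rotation phi (- x) = - rotation phi x.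
Proof. by rewrite -(scaleN1r x) rotation_scale scaleN1r. Qed.

Lemma unit_vec_rotation phi x :
  unit_vec (rotation phi x) = rotation phi (unit_vec x).
Proof.
by rewrite /unit_vec enorm_rotation /rotation; congr (_, _) => /=; ring.
Qed.

Lemma continuous_rotation phi : continuous (@rotation R phi).
Proof.
move=> x.
have c1 : {for x, continuous (fun y : plane R => cos phi * y.1 - sin phi * y.2)}.
  apply: cvgB; apply: cvgM; try exact: cvg_cst; [exact: cvg_fst|exact: cvg_snd].
have c2 : {for x, continuous (fun y : plane R => sin phi * y.1 + cos phi * y.2)}.
  apply: cvgD; apply: cvgM; try exact: cvg_cst; [exact: cvg_fst|exact: cvg_snd].
exact: (cvg_pair c1 c2).
Qed.

Lemma differentiable_rotation phi x : differentiable (@rotation R phi) x.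
Proof.
have lin : linear (@rotation R phi : plane R -> plane R).
  by move=> a u v; rewrite rotation_add rotation_scale.
pose rL := GRing.isLinear.Build _ _ _ _ _ lin.
pose r : {linear (plane R : normedModType R) -> (plane R : normedModType R)} :=
  HB.pack (@rotation R phi) rL.
exact: (@linear_differentiable _ _ _ r x (@continuous_rotation phi)).
Qed.

Lemma differentiable_rotation_comp phi f x : differentiable f (rotation phi x) ->
  differentiable (fun y => f (rotation phi y)) x.
Proof.
by move=> df; exact: differentiable_comp (differentiable_rotation phi x) df.
Qed.

(** By linearity of the rotation the difference quotients already coincide before the limit, so the
    identity holds for every [f]. *)
Lemma derive_rotation phi f v x :
  'D_v (fun y => f (rotation phi y)) x = 'D_(rotation phi v) f (rotation phi x).
Proof.
rewrite /derive.
rewrite [X in lim (X @ _)](_ : _ = (fun h => h^-1 *: ((f \o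
    shift (rotation phi x)) (h *: rotation phi v) - f (rotation phi x))))//.
by apply/funext => h /=; rewrite rotation_add rotation_scale.
Qed.

Lemma derive_coord f x v : differentiable f x ->
  'D_v f x = v.1 * 'D_(e1 R) f x + v.2 * 'D_(e2 R) f x.
Proof.
move=> df; rewrite !deriveE//.
have {1}-> : v = v.1 *: e1 R + v.2 *: e2 R.
  by case: v => a b; rewrite /e1 /e2; congr (_, _); rewrite /= /GRing.scale /=; ring.
by rewrite linearD !linearZ.
Qed.

(** Since [Cn] quantifies over all directions, the induction closes: differentiating the rotated
    function along [v] rotates the derivative of [psi] along [rotation phi v]. *)
Lemma Cn_rotation n phi psi : Cn n psi -> Cn n (fun x => psi (rotation phi x)).
Proof.
elim: n psi => [|n IH] psi /=.
  move=> cpsi x; exact: (continuous_comp (continuous_rotation (x := x)) (cpsi _)).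
move=> [dpsi Dpsi]; split=> [x|v]; first exact: differentiable_rotation_comp.
rewrite (_ : (fun x => _) = fun x => 'D_(rotation phi v) psi (rotation phi x)).
  exact: (IH ('D_(rotation phi v) psi) (Dpsi _)).
by apply/funext => x; rewrite derive_rotation.
Qed.

Lemma test_function_rotation phi psi : test_function psi ->
  test_function (fun x => psi (rotation phi x)).
Proof.
move=> [Cpsi [r psi0]]; split=> [n|]; first exact: Cn_rotation.
by exists r => x rx; apply: psi0; rewrite enorm_rotation.
Qed.

Lemma test_function_differentiable psi x :
  test_function psi -> differentiable psi x.
Proof. by move=> [/(_ 1%N) []]. Qed.

Lemma test_function_derive psi v :
  test_function psi -> test_function ('D_v psi).
Proof.
move=> [Cpsi [r psi0]]; split=> [n|]; first by have [_] := Cpsi n.+1; exact.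
exists r => x rx.
(* The region [r < enorm y] is open, so [psi] vanishes on a neighbourhood of [x]. *)
rewrite (@near_eq_derive _ _ _ psi (cst 0)) ?derive_cst//.
have : \forall y \near x, r < enorm y by exact: (cvgr_gt _ (@continuous_enorm x)).
by apply: filterS => y; exact: psi0.
Qed.

Lemma derive_lincomb (g1 g2 : plane R -> R) (a b : R) v x :
  differentiable g1 x -> differentiable g2 x ->
  'D_v (fun y => a * g1 y + b * g2 y) x = a * 'D_v g1 x + b * 'D_v g2 x.
Proof.
move=> dg1 dg2.
have k1 : derivable (a \*: g1) x v by apply: derivableZ; exact: diff_derivable.
have k2 : derivable (b \*: g2) x v by apply: derivableZ; exact: diff_derivable.
apply: etrans (deriveD k1 k2) _.
by congr (_ + _); apply: deriveZ; exact: diff_derivable.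
Qed.

(* The coefficients of each mixed derivative cancel separately, so Schwarz's
   theorem plays no role. *)
Lemma laplacian_rotation phi psi x : test_function psi ->
  laplacian (fun y => psi (rotation phi y)) x = laplacian psi (rotation phi x).
Proof.
move=> tpsi.
have D1 v : (fun y => 'D_v (fun z => psi (rotation phi z)) y) =
    (fun y => (rotation phi v).1 * 'D_(e1 R) psi (rotation phi y) +
       (rotation phi v).2 * 'D_(e2 R) psi (rotation phi y)).
  apply/funext => y; apply: etrans (derive_rotation phi psi v y) _.
  exact: (derive_coord _ (test_function_differentiable _ tpsi)).
have d v y : differentiable ('D_v psi) y.
  exact/test_function_differentiable/test_function_derive.
set p1 := 'D_(e1 R) psi in D1; set p2 := 'D_(e2 R) psi in D1.
have D2 v : 'D_v (fun y => 'D_v (fun z => psi (rotation phi z)) y) x =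
    (rotation phi v).1 * ((rotation phi v).1 * 'D_(e1 R) p1 (rotation phi x) +
      (rotation phi v).2 * 'D_(e2 R) p1 (rotation phi x)) +
    (rotation phi v).2 * ((rotation phi v).1 * 'D_(e1 R) p2 (rotation phi x) +
      (rotation phi v).2 * 'D_(e2 R) p2 (rotation phi x)).
  rewrite D1.
  apply: etrans (derive_rotation phi (fun y => (rotation phi v).1 * p1 y +
    (rotation phi v).2 * p2 y) v x) _.
  apply: etrans (derive_lincomb _ _ _ (d _ _) (d _ _)) _.
  by congr (_ * _ + _ * _); exact: derive_coord.
have cs := cos2sin2 phi.
(* This is the invariance of the trace of a matrix under an orthogonal change of basis, here for the
   second derivatives. *)
have alg (a11 a12 a21 a22 : R) : let w1 := rotation phi (e1 R) in
    let w2 := rotation phi (e2 R) in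
    w1.1 * (w1.1 * a11 + w1.2 * a12) + w1.2 * (w1.1 * a21 + w1.2 * a22) +
    (w2.1 * (w2.1 * a11 + w2.2 * a12) + w2.2 * (w2.1 * a21 + w2.2 * a22)) =
    a11 + a22.
  by rewrite /rotation /e1 /e2 /=; ring: cs.
exact: etrans (congr2 +%R (D2 (e1 R)) (D2 (e2 R))) (alg _ _ _ _).
Qed.

End PlaneDerivatives.

(** * Measurability and square-integrability in the plane *)

Section PlaneIntegrability.
Variable R : realType.
Local Notation mR := (measurableTypeR R).
Local Notation mu2 := (lebesgue2 R).
Implicit Types (phi r : R) (f g u : plane R -> R[i]) (psi : plane R -> R).

Let box (i : (rat * rat) * (rat * rat)) : set (plane R) :=
  `]ratr i.1.1, ratr i.1.2[%classic `*` `]ratr i.2.1, ratr i.2.2[%classic.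

Lemma open_measurable_plane (U : set (plane R)) :
  open U -> measurable (U : set (R * R)).
Proof.
move=> oU.
(* Boxes with rational corners that do not fit in [U] are replaced by [set0], so that the union runs
   over a fixed countable index type. *)
have -> : U = \bigcup_i (if `[< box i `<=` U >] then box i else set0).
  apply/seteqP; split=> [[x y] Uxy|x [i _]]; last by case: asboolP => // + ?; exact.
  have /nbhs_ballP[e /= e0 eU] : nbhs (x, y) U by exact: open_nbhs_nbhs.
  have xl : x - e < x by lra.
  have xr : x < x + e by lra.
  have yl : y - e < y by lra.
  have yr : y < y + e by lra.
  have [a xa] := rat_in_itvoo xl; have [b xb] := rat_in_itvoo xr.
  have [c yc] := rat_in_itvoo yl; have [d yd] := rat_in_itvoo yr.
  exists ((a, b), (c, d)) => //; case: asboolP => [_|[]].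
    move: xa xb yc yd; rewrite /box !in_itv /= => /andP[_ ?] /andP[? _].
    by move=> /andP[_ ?] /andP[? _]; split; rewrite /= in_itv /=; apply/andP.
  move=> [x' y'] [] /=; rewrite !in_itv /= => /andP[? ?] /andP[? ?]; apply: eU.
  move: xa xb yc yd; rewrite !in_itv /= => /andP[? ?] /andP[? ?] /andP[? ?] /andP[? ?].
  by split; rewrite /ball /= ltr_norml; apply/andP; split; lra.
apply: countable_bigcupT_measurable => [|i]; first exact: countableP.
by case: asboolP => // _; apply: measurableX.
Qed.

Lemma continuous_measurable_plane psi :
  continuous psi -> measurable_fun setT (psi : R * R -> R).
Proof.
move=> /continuousP cpsi.
apply: (measurability _ (RGenOInfty.measurableE R)) => _ [_ [a ->] <-].
by rewrite setTI; apply: open_measurable_plane; apply: cpsi; exact: interval_open.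
Qed.

Lemma measurable_cdisk r : measurable (cdisk r : set (mR * mR)).
Proof.
have h : measurable_fun setT (@enorm R : R * R -> R).
  exact: (continuous_measurable_plane (@continuous_enorm R)).
have k : measurable (cdisk r : set (R * R)).
  rewrite (_ : cdisk r = setT `&` @enorm R @^-1` `]-oo, r]).
    by apply: h => //; exact: measurable_itv.
  by rewrite setTI; apply/seteqP; split=> x; rewrite /cdisk /= in_itv.
exact: k.
Qed.

(** The enclosing square is a product of intervals, from which finite measure and compactness are
    obtained. *)
Lemma cdisk_square r : cdisk r `<=` `[- r, r]%classic `*` `[- r, r]%classic.
Proof.
move=> x xr; have r0 : 0 <= r by apply: le_trans xr; exact: sqrtr_ge0.
have : x.1 ^+ 2 + x.2 ^+ 2 <= r ^+ 2.
  rewrite -(sqr_sqrtr (addr_ge0 (sqr_ge0 x.1) (sqr_ge0 x.2))).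
  by rewrite lerXn2r// nnegrE sqrtr_ge0.
move=> h; have h1 := sqr_ge0 x.1; have h2 := sqr_ge0 x.2.
split; rewrite /= in_itv /= -ler_norml -(ler_pXn2r (n := 2)) ?nnegrE//
  real_normK ?num_real//; lra.
Qed.

Lemma cdisk_finite r : (mu2 (cdisk r : set (mR * mR)) < +oo)%E.
Proof.
have mI : measurable (`[- r, r]%classic : set mR) by exact: measurable_itv.
apply: (@le_lt_trans _ _ (mu2 (`[- r, r]%classic `*` `[- r, r]%classic))).
  apply: le_measure; rewrite ?inE.
  - exact: measurable_cdisk.
  - exact: measurableX.
  - exact: cdisk_square.
rewrite [X in (X < _)%E](product_measure1E _ _ mI mI).
have L : (@lebesgue_measure R `[(- r)%R, r]%classic < +oo)%E.
  by rewrite lebesgue_measure_itv /=; case: ifP => //; rewrite -EFinB ltry.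
apply: lte_mul_pinfty => //.
by rewrite ge0_fin_numE//; exact: measure_ge0.
Qed.

Lemma continuous_bounded_cdisk psi r : continuous psi ->
  exists M, forall x, cdisk r x -> `|psi x| <= M.
Proof.
move=> cpsi.
have K : compact (`[- r, r]%classic `*` `[- r, r]%classic : set (plane R)).
  by apply: compact_setX; exact: segment_compact.
have /compact_bounded[M [_ bM]] := continuous_compact
  (continuous_subspaceT cpsi) K.
(* Boundedness is stated for every number strictly above [M], hence the added 1. *)
exists (M + 1) => x /cdisk_square xr; apply: (bM (M + 1)); first by lra.
by exists x.
Qed.

Definition sqnorm f (x : plane R) : R := complex.Re (f x) ^+ 2 + complex.Im (f x) ^+ 2.

Lemma cLp2P D f : cLp 2%:E D f <->
  [/\ measurable_fun D (fun x => complex.Re (f x)),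
      measurable_fun D (fun x => complex.Im (f x)) &
      (\int[mu2]_(x in D) (sqnorm f x)%:E < +oo)%E].
Proof.
have E : (\int[mu2]_x (`|(EFin \o patch (fun=> 0%R) D (@normc R \o f)) x| `^ 2)
    = \int[mu2]_(x in D) (sqnorm f x)%:E)%E.
  rewrite [RHS]integral_mkcond; apply: eq_integral => x _ /=.
  rewrite !patchE; case: ifP => _; last by rewrite normr0 powR0 ?pnatr_eq0.
  rewrite powR_mulrn// real_normK ?num_real// /normc /sqnorm /=.
  by case: (f x) => a b /=; rewrite sqr_sqrtr// addr_ge0 ?sqr_ge0.
split=> -[mRe mIm h]; split=> //; move: h.
  by move=> /(poweR_lty 2); rewrite powR_Lnorm// E.
by rewrite -E unlock; exact: poweR_lty.
Qed.

End PlaneIntegrability.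

(** * Stability of local square-integrability and pairing with test functions *)

Section WeakDerivatives.
Variable R : realType.
Local Notation mR := (measurableTypeR R).
Local Notation mu2 := (lebesgue2 R).
Implicit Types (phi r a b : R) (f g u : plane R -> R[i]) (psi : plane R -> R).

Lemma measurable_rotation phi :
  measurable_fun setT (rotation phi : R * R -> R * R).
Proof. exact: (proj1 (measure_preserving_rotation phi)). Qed.

Lemma mem_cdisk_rotation phi r (x : plane R) :
  (rotation phi x \in cdisk r) = (x \in cdisk r).
Proof. by apply/idP/idP; rewrite !inE /cdisk /= enorm_rotation. Qed.

(** Each disk centred at the origin is invariant, so restricting to it commutes with rotating. *)
Lemma L2loc_rotation phi f :
  L2loc f -> L2loc (fun x => f (rotation phi x)).
Proof.
move=> Lf r; have /cLp2P[mRe mIm fin] := Lf r.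
have mD : measurable (cdisk r : set (R * R)) by exact: measurable_cdisk.
have comp (h : R * R -> R) : measurable_fun (cdisk r) h ->
    measurable_fun (cdisk r) (h \o rotation phi : R * R -> R).
  move=> mh; apply: (measurable_comp mD _ mh).
    by move=> _ [x xr <-]; rewrite /cdisk /= enorm_rotation.
  exact: measurable_funS (measurable_rotation phi).
apply/cLp2P; split; [exact: comp mRe|exact: comp mIm|].
move: fin; rewrite integral_mkcond [X in _ -> (X < _)%E]integral_mkcond.
rewrite -(integral_rotation phi); congr (_ < _)%E; apply: eq_integral => x _.
by rewrite !patchE mem_cdisk_rotation.
Qed.

Lemma measurable_sqnorm (D : set (R * R)) f :
  measurable_fun D (fun x => complex.Re (f x)) ->
  measurable_fun D (fun x => complex.Im (f x)) -> measurable_fun D (sqnorm f).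
Proof. by move=> m1 m2; apply: measurable_funD; apply: measurable_funX. Qed.

Lemma integrable_sqnorm (D : set (R * R)) f :
  measurable_fun D (fun x => complex.Re (f x)) ->
  measurable_fun D (fun x => complex.Im (f x)) ->
  (\int[mu2]_(x in D) (sqnorm f x)%:E < +oo)%E ->
  mu2.-integrable D (EFin \o sqnorm f).
Proof.
move=> m1 m2 foo; apply/integrableP; split.
  by apply/measurable_EFinP; exact: measurable_sqnorm m1 m2.
rewrite (eq_integral (fun x : mR * mR => (sqnorm f x)%:E))// => x _.
by rewrite /= ger0_norm// addr_ge0 ?sqr_ge0.
Qed.

(** This serves the weak derivatives in rotated directions, which are real combinations of those
    along the axes. The dominating function comes from $(s+t)^2 \le 2s^2+2t^2$. *)
Lemma L2loc_lincomb a b f g : L2loc f -> L2loc g ->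
  L2loc (fun x => a%:C * f x + b%:C * g x)%C.
Proof.
move=> Lf Lg r; have /cLp2P[mRf mIf ff] := Lf r; have /cLp2P[mRg mIg fg] := Lg r.
have mD : measurable (cdisk r : set (mR * mR)) by exact: measurable_cdisk.
have ReE x : complex.Re (a%:C * f x + b%:C * g x)%C =
    a * complex.Re (f x) + b * complex.Re (g x).
  by case: (f x) => ? ?; case: (g x) => ? ? /=; ring.
have ImE x : complex.Im (a%:C * f x + b%:C * g x)%C =
    a * complex.Im (f x) + b * complex.Im (g x).
  by case: (f x) => ? ?; case: (g x) => ? ? /=; ring.
have mlin (h k : R * R -> R) : measurable_fun (cdisk r) h ->
    measurable_fun (cdisk r) k ->
    measurable_fun (cdisk r) (fun x => a * h x + b * k x).
  by move=> m1 m2; apply: measurable_funD; apply: measurable_funM.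
have mR' : measurable_fun (cdisk r : set (R * R))
    (fun x => complex.Re (a%:C * f x + b%:C * g x)%C).
  by under eq_fun do rewrite ReE; exact: mlin.
have mI' : measurable_fun (cdisk r : set (R * R))
    (fun x => complex.Im (a%:C * f x + b%:C * g x)%C).
  by under eq_fun do rewrite ImE; exact: mlin.
apply/cLp2P; split=> //.
have intg := integrableD mD (integrableZl mD (2 * a ^+ 2) (integrable_sqnorm mRf mIf ff))
  (integrableZl mD (2 * b ^+ 2) (integrable_sqnorm mRg mIg fg)).
have := integrable_lty mD intg; apply: le_lt_trans.
apply: ge0_le_integral => //.
- by move=> x _; rewrite lee_fin addr_ge0 ?sqr_ge0.
- by apply/measurable_EFinP; exact: measurable_sqnorm mR' mI'.
- exact: measurable_int intg.
- move=> x _; rewrite /= -!EFinM -EFinD lee_fin /sqnorm ReE ImE.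
  have sq2 (s t : R) : (s + t) ^+ 2 <= 2 * s ^+ 2 + 2 * t ^+ 2.
    by have := sqr_ge0 (s - t); nra.
  apply: (le_trans (lerD (sq2 _ _) (sq2 _ _))).
  by rewrite !exprMn; nra.
Qed.

Definition cintegrable f : Prop :=
  mu2.-integrable setT (fun x => (complex.Re (f x))%:E) /\
  mu2.-integrable setT (fun x => (complex.Im (f x))%:E).

Lemma cint_lincomb a b f g : cintegrable f -> cintegrable g ->
  cint (fun x => a%:C * f x + b%:C * g x)%C = (a%:C * cint f + b%:C * cint g)%C.
Proof.
move=> [f1 f2] [g1 g2]; rewrite /cint.
have lin (h k : plane R -> R) : mu2.-integrable setT (EFin \o h) ->
    mu2.-integrable setT (EFin \o k) ->
    Rintegral mu2 setT (fun x => a * h x + b * k x) =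
    a * Rintegral mu2 setT h + b * Rintegral mu2 setT k.
  move=> ih ik; rewrite RintegralD//; first by rewrite !RintegralZl.
    exact: (integrableZl measurableT a ih).
  exact: (integrableZl measurableT b ik).
rewrite (_ : (fun x => complex.Re _) =
    fun x => a * complex.Re (f x) + b * complex.Re (g x)); last first.
  by apply/funext => x; case: (f x) => ? ?; case: (g x) => ? ? /=; ring.
rewrite (_ : (fun x => complex.Im _) =
    fun x => a * complex.Im (f x) + b * complex.Im (g x)); last first.
  by apply/funext => x; case: (f x) => ? ?; case: (g x) => ? ? /=; ring.
by rewrite !lin//; apply/eqP; rewrite eq_complex /=; apply/andP; split;
  apply/eqP; ring.
Qed.

(** The product lives on a disk of finite measure, where [u] is integrable because it is
    square-integrable, and [psi] is bounded there. *)
Lemma cintegrable_L2loc u psi r : L2loc u -> continuous psi ->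
  (forall x, r < enorm x -> psi x = 0) ->
  cintegrable (fun x => u x * (psi x)%:C)%C.
Proof.
move=> Lu cpsi psi0; have /cLp2P[mRe mIm fin] := Lu r.
have mD : measurable (cdisk r : set (mR * mR)) by exact: measurable_cdisk.
have main (h : plane R -> R) : measurable_fun (cdisk r : set (R * R)) h ->
    (forall x, h x ^+ 2 <= sqnorm u x) ->
    mu2.-integrable setT (fun x => (h x * psi x)%:E).
  move=> mh hu.
  have -> : (fun x => (h x * psi x)%:E) =
      (EFin \o (fun x => h x * psi x)) \_ (cdisk r).
    apply/funext => x; rewrite patchE; case: ifPn => //.
    by rewrite notin_setE /cdisk /= => /negP; rewrite -ltNge => /psi0 ->; rewrite mulr0.
  apply/(integrable_mkcond _ mD).1.
  have hint : mu2.-integrable (cdisk r) (EFin \o h).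
    have i1 : mu2.-integrable (cdisk r) (EFin \o cst 1).
      apply/integrableP; split; first exact/measurable_EFinP.
      rewrite (eq_integral (cst 1%E)) ?integral_cst ?mul1e ?cdisk_finite//.
      by move=> x _; rewrite /= normr1.
    have i2 : mu2.-integrable (cdisk r) (EFin \o sqnorm u) by exact: integrable_sqnorm.
    (* The domination is $|h| \le 1 + h^2$, a consequence of $(|h|-1)^2 \ge 0$. *)
    apply: le_integrable (integrableD mD i1 i2) => //.
      by apply/measurable_EFinP.
    move=> x _; rewrite /= lee_fin.
    have := hu x; have := sqr_ge0 (h x); have := sqr_ge0 (`|h x| - 1).
    have := real_normK (num_real (h x)).
    have := ler_norm (1 + sqnorm u x).
    nra.
  have [M bM] := continuous_bounded_cdisk r cpsi.
  have mpsi : measurable_fun (cdisk r : set (mR * mR)) psi.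
    apply: (@measurable_funS _ _ _ _ setT) => //.
    exact: continuous_measurable_plane cpsi.
  apply: (integrableMl mD hint mpsi).
  exists M; split; first exact: num_real.
  by move=> N MN x xr; apply: le_trans (bM x xr) (ltW MN).
split.
- rewrite (_ : (fun x => _) = fun x => (complex.Re (u x) * psi x)%:E).
    by apply: main => // x; rewrite /sqnorm lerDl sqr_ge0.
  by apply/funext => x; case: (u x) => ? ? /=; congr EFin; ring.
- rewrite (_ : (fun x => _) = fun x => (complex.Im (u x) * psi x)%:E).
    by apply: main => // x; rewrite /sqnorm lerDr sqr_ge0.
  by apply/funext => x; case: (u x) => ? ? /=; congr EFin; ring.
Qed.

End WeakDerivatives.

(** * Rotation of scattered fields *)

Section RotatedField.
Variable R : realType.
Implicit Types (phi r k : R) (f g q u us : plane R -> R[i]) (psi : plane R -> R).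
Implicit Types (x v w theta : plane R).
Local Open Scope complex_scope.

(** The local square-integrability assumptions make all pairings integrable, which justifies
    splitting the integrals along the two axes. *)
Lemma weak_derivative_direction v u g1 g2 :
  L2loc u -> L2loc g1 -> L2loc g2 ->
  weak_derivative (e1 R) u g1 -> weak_derivative (e2 R) u g2 ->
  weak_derivative v u (fun x => v.1%:C * g1 x + v.2%:C * g2 x).
Proof.
move=> Lu L1 L2 W1 W2 psi tpsi.
have [r psi0] := tpsi.2.
have cint_test (h : plane R -> R[i]) psi' : L2loc h -> test_function psi' ->
    cintegrable (fun x => h x * (psi' x)%:C).
  move=> Lh [C0 [s psi'0]].
  by apply: (cintegrable_L2loc Lh _ psi'0); exact: (C0 0%N).
have dir (x : plane R) : u x * ('D_v psi x)%:C =
    v.1%:C * (u x * ('D_(e1 R) psi x)%:C) + v.2%:C * (u x * ('D_(e2 R) psi x)%:C).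
  rewrite (derive_coord v (test_function_differentiable x tpsi)).
  by move: ('D_(e1 R) psi x) ('D_(e2 R) psi x) => a b; rewrite rmorphD !rmorphM /=; ring.
rewrite (funext dir) cint_lincomb; last 2 first.
- exact: cint_test (test_function_derive _ tpsi).
- exact: cint_test (test_function_derive _ tpsi).
rewrite (W1 _ tpsi) (W2 _ tpsi) !mulrN -opprD; congr (- _).
rewrite -cint_lincomb; [|exact: cint_test|exact: cint_test].
by congr cint; apply/funext => x; ring.
Qed.

(** The hypothesis is tested against [psi] composed with the inverse rotation, and a change of
    variables turns this back into [psi]. *)
Lemma weak_derivative_rotation phi v u g :
  weak_derivative (rotation phi v) u g ->
  weak_derivative v (fun x => u (rotation phi x)) (fun x => g (rotation phi x)).
Proof.
move=> W psi tpsi.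
have := W _ (test_function_rotation (- phi) tpsi).
rewrite -(cint_rotation phi) -[in X in _ = X -> _](cint_rotation phi).
have E1 x : ('D_(rotation phi v) (fun y => psi (rotation (- phi) y)))
    (rotation phi x) = 'D_v psi x.
  by apply: etrans (derive_rotation _ _ _ _) _; rewrite !rotationK.
by under eq_fun do rewrite E1; under [in X in _ = X -> _]eq_fun do rewrite rotationK.
Qed.

Lemma H1loc_rotation phi u : H1loc u -> H1loc (fun x => u (rotation phi x)).
Proof.
move=> [Lu [g1 L1 W1] [g2 L2 W2]].
(* Along an axis [v], the rotated field calls for the weak derivative of [u] along [rotation phi v],
   in general not an axis. *)
have main v : exists2 g, L2loc g & weak_derivative v (fun x => u (rotation phi x)) g.
  eexists; last first.
    exact: (weak_derivative_rotation (weak_derivative_direction _ Lu L1 L2 W1 W2)).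
  exact: (L2loc_rotation phi (L2loc_lincomb _ _ L1 L2)).
by split; [exact: L2loc_rotation|exact: main|exact: main].
Qed.

Lemma extend0_rotation phi q x :
  extend0 (fun y => q (rotation phi y)) x = extend0 q (rotation phi x).
Proof. by rewrite /extend0 /patch /unit_disk mem_cdisk_rotation. Qed.

(** The equation for [us] is tested against [psi] composed with the inverse rotation. Each of the
    three integrals is then carried over by a change of variables, using the invariance of the
    Laplacian and of [dot]. *)
Lemma helmholtz_rotation k phi q theta us :
  helmholtz k q (rotation phi theta) us ->
  helmholtz k (fun x => q (rotation phi x)) theta (fun x => us (rotation phi x)).
Proof.
move=> H psi tpsi.
have tpsi' := test_function_rotation (- phi) tpsi.
have change_var (F G : plane R -> R[i]) :
    (forall x, F x = G (rotation phi x)) -> cint F = cint G.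
  by move=> FG; rewrite -(cint_rotation phi G) (funext FG).
have lapE x : laplacian psi x =
    laplacian (fun y => psi (rotation (- phi) y)) (rotation phi x).
  by apply: etrans _ (esym (laplacian_rotation _ _ tpsi)); rewrite rotationK.
apply: etrans (congr2 (fun a b => a + (k ^+ 2)%:C * b) _ _)
  (etrans (H _ tpsi') (congr1 (fun a => - (k ^+ 2)%:C * a) (esym _))).
- apply: change_var => x.
  exact: (congr1 (fun t : R => us (rotation phi x) * t%:C) (lapE x)).
- by apply: change_var => x; rewrite extend0_rotation rotationK.
- apply: change_var => x.
  by rewrite extend0_rotation rotationK /plane_wave dot_rotation.
Qed.

Lemma near_infinity_rotation phi (P : plane R -> Prop) :
  near_infinity P -> near_infinity (fun x => P (rotation phi x)).
Proof. by move=> [r Pr]; exists r => x rx; apply: Pr; rewrite enorm_rotation. Qed.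

Lemma near_infinity_and (P Q : plane R -> Prop) :
  near_infinity P -> near_infinity Q -> near_infinity (fun x => P x /\ Q x).
Proof.
move=> [r Pr] [s Qs]; exists (Num.max r s) => x; rewrite gt_max => /andP[? ?].
by split; [exact: Pr|exact: Qs].
Qed.

Lemma cdifferentiable_rotation phi us x : cdifferentiable us (rotation phi x) ->
  cdifferentiable (fun y => us (rotation phi y)) x.
Proof.
move=> [dRe dIm]; split.
  exact: (differentiable_rotation_comp dRe).
exact: (differentiable_rotation_comp dIm).
Qed.

Lemma cderive_coord us x v : cdifferentiable us x ->
  cderive (e1 R) us x * v.1%:C + cderive (e2 R) us x * v.2%:C = cderive v us x.
Proof.
move=> [dRe dIm]; rewrite /cderive (derive_coord v dRe) (derive_coord v dIm).
move: ('D_(e1 R) _ x) ('D_(e2 R) _ x) ('D_(e1 R) _ x) ('D_(e2 R) _ x).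
move=> a b c d; apply/eqP; rewrite eq_complex /=.
by apply/andP; split; apply/eqP; ring.
Qed.

(** Where the field is differentiable, the gradient term is the directional derivative along
    [unit_vec x], and this direction rotates with [x]. Both parts of the condition are therefore
    taken on one common neighbourhood of infinity. *)
Lemma sommerfeld_rotation k phi us :
  sommerfeld k us -> sommerfeld k (fun x => us (rotation phi x)).
Proof.
move=> [dus lus]; split.
  have := near_infinity_rotation phi dus.
  by move=> [r H]; exists r => x /H; exact: cdifferentiable_rotation.
move=> eps eps0.
have := near_infinity_rotation phi (near_infinity_and dus (lus _ eps0)).
move=> [r H]; exists r => x /H[dx].
rewrite (cderive_coord _ dx) (cderive_coord _ (cdifferentiable_rotation dx)).
rewrite enorm_rotation unit_vec_rotation.
by rewrite /cderive (derive_rotation phi (fun y => complex.Re (us y)))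
  (derive_rotation phi (fun y => complex.Im (us y))).
Qed.

Lemma is_scattered_field_rotation k phi q theta us :
  is_scattered_field k q (rotation phi theta) us ->
  is_scattered_field k (fun x => q (rotation phi x)) theta
    (fun x => us (rotation phi x)).
Proof.
move=> [? ? ?]; split; [exact: H1loc_rotation|exact: helmholtz_rotation|].
exact: sommerfeld_rotation.
Qed.

End RotatedField.

(** * Far fields and processed data *)

Section FarField.
Variable R : realType.
Local Notation mR := (measurableTypeR R).
Local Notation mu2 := (lebesgue2 R).
Implicit Types (phi r k : R) (f g q u us : plane R -> R[i]).
Implicit Types (x v w theta xhat p : plane R).
Local Open Scope complex_scope.

(** Balls of the maximum norm are squares, so their measure is a product of two lengths. *)
Lemma lebesgue2_ball_gt0 x (e : R) : 0 < e ->
  (0 < mu2 (ball x e : set (mR * mR)))%E.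
Proof.
move=> e0; have ballE (y : R) :
    ball y e = `]y - e, y + e[%classic :> set mR by exact: ball_itv.
have -> : (ball x e : set (mR * mR)) = (ball x.1 e : set mR) `*` (ball x.2 e : set mR).
  by apply/seteqP; split=> y.
have m1 (y : R) : (measurable (ball y e : set mR)).
  by rewrite ballE; exact: measurable_itv.
rewrite [X in (_ < X)%E](product_measure1E _ _ (m1 _) (m1 _)).
have pos (y : R) : (0 < @lebesgue_measure R (ball y e))%E.
  rewrite ballE lebesgue_measure_itv /= lte_fin ifT; last lra.
  by rewrite -EFinB lte_fin; lra.
by apply: mule_gt0; exact: pos.
Qed.

(** A nonzero value would persist on a ball, which has positive measure and cannot lie in a null
    set. *)
Lemma ae_eq0_continuous (h : plane R -> R) r :
  (forall x, r < enorm x -> {for x, continuous h}) ->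
  {ae mu2, forall x, h x = 0} -> forall x, r < enorm x -> h x = 0.
Proof.
move=> ch [A [mA A0 hA]] x rx; apply/eqP/negPn/negP => hx.
have : \forall y \near x, h y != 0 by exact: cvgr_neq0 (ch x rx) hx.
move=> /nbhs_ballP[e /= e0 he].
have mB : measurable (ball x e : set (mR * mR)).
  exact: (open_measurable_plane (ball_open x e)).
have sub : (ball x e : set (mR * mR)) `<=` A.
  by move=> y /he hy; apply: hA => /= hy0; rewrite hy0 eqxx in hy.
have := lebesgue2_ball_gt0 x e0; rewrite ltNge => /negP; apply.
by rewrite -A0; apply: le_measure => //; rewrite inE.
Qed.

(* Well-posedness gives uniqueness almost everywhere only, but the radiation
   condition selects representatives that are continuous near infinity. *)
Lemma ae_eq_near_infinity u us :
  near_infinity (cdifferentiable u) -> near_infinity (cdifferentiable us) ->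
  {ae mu2, forall x, u x = us x} -> near_infinity (fun x => u x = us x).
Proof.
move=> du dus ae; have [r H] := near_infinity_and du dus; exists r.
have cont (P : R[i] -> R) : (forall x, r < enorm x ->
      differentiable (fun y => P (u y)) x /\ differentiable (fun y => P (us y)) x) ->
    forall x, r < enorm x -> P (u x) = P (us x).
  move=> dP x rx; apply/eqP; rewrite -subr_eq0; apply/eqP; move: x rx.
  apply: ae_eq0_continuous => [x rx|].
    have [d1 d2] := dP x rx.
    by apply: cvgB; exact: differentiable_continuous.
  apply: (negligibleS _ ae) => x /= hx e; apply: hx.
  by rewrite e subrr.
move=> x rx; apply/eqP; rewrite eq_complex; apply/andP; split; apply/eqP.
  by move: x rx; apply: cont => x /H[[? _] [? _]].
by move: x rx; apply: cont => x /H[[_ ?] [_ ?]].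
Qed.

Lemma enorm_scale r x : 0 <= r -> enorm (r *: x) = r * enorm x.
Proof.
move=> r0; rewrite /enorm /= /GRing.scale /= !exprMn -mulrDr.
by rewrite sqrtrM ?sqr_ge0// sqrtr_sqr ger0_norm.
Qed.

Lemma unit_vec_scale r x : 0 < r -> circle x -> unit_vec (r *: x) = x.
Proof.
move=> r0 cx; rewrite /unit_vec enorm_scale ?ltW// cx mulr1.
by case: x cx => a b _; rewrite /= /GRing.scale /=; congr (_, _); field; rewrite gt_eqF.
Qed.

Lemma cis_neq0 (t : R) : cis t != 0.
Proof.
apply/eqP => /eqP; rewrite eq_complex /= => /andP[/eqP c0 /eqP s0].
by have := cos2Dsin2 t; rewrite c0 s0; lra.
Qed.

Lemma far_factor_neq0 k r : 0 < k -> 0 < r -> far_factor k r != 0.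
Proof.
move=> k0 r0.
have inv (s : R) : 0 < s -> (Num.sqrt s)%:C != 0 :> R[i].
  by move=> s0; rewrite fmorph_eq0 gt_eqF// sqrtr_gt0.
have h : 0 < 8 * k * pi by rewrite !mulr_gt0// pi_gt0.
by rewrite /far_factor !mulf_neq0 ?invr_neq0 ?cis_neq0 ?inv.
Qed.

(** Along the ray through [xhat] the two expansions share a nonzero factor, so the two values differ
    by at most [(c1 + c2) / s] at distance [s], for all large [s]. *)
Lemma far_field_unique k us f g xhat : 0 < k ->
  is_far_field k us f -> is_far_field k us g -> circle xhat -> f xhat = g xhat.
Proof.
move=> k0 [c1 Hf] [c2 Hg] cx; have [r H] := near_infinity_and Hf Hg.
apply/eqP; rewrite -subr_eq0; apply/eqP; apply: ComplexField.Normc.eq0_normc.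
apply/eqP/negPn/negP => d0.
set d := ComplexField.Normc.normc _ in d0.
have dpos : 0 < d.
  by rewrite lt_neqAle eq_sym d0 /= /d; case: (_ - _) => a b; exact: sqrtr_ge0.
(* Chosen so that [s] exceeds [r] and [d * s] exceeds [c1 + c2]; absolute values are taken since
   these constants may be negative. *)
pose s := `|r| + 1 + (`|c1| + `|c2|) / d.
have q0 : 0 <= (`|c1| + `|c2|) / d by rewrite divr_ge0 ?addr_ge0// ltW.
have s0 : 0 < s by rewrite /s; have := normr_ge0 r; lra.
have es : enorm (s *: xhat) = s by rewrite enorm_scale ?(ltW s0)// cx mulr1.
have sr : r < enorm (s *: xhat) by rewrite es /s; have := ler_norm r; lra.
have [[rem1 [E1 b1]] [rem2 [E2 b2]]] := H _ sr.
have := E1; rewrite E2 (unit_vec_scale s0 cx).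
rewrite es in b1 b2 *.
move=> /(mulfI (far_factor_neq0 k0 s0)) E.
have : d <= (c1 + c2) / s.
  rewrite mulrDl.
  have -> : d = normc (rem2 + - rem1).
    congr (ComplexField.Normc.normc _).
    by apply/eqP; rewrite subr_eq addrAC -subr_eq opprK addrC E addrC.
  apply: le_trans (le_normcD _ _) _; rewrite addrC; apply: lerD => //.
  by rewrite normcN.
rewrite ler_pdivlMr//; apply/negP; rewrite -ltNge.
have -> : d * s = d * (`|r| + 1) + (`|c1| + `|c2|).
  by rewrite /s; field.
have := ler_norm c1; have := ler_norm c2; have := normr_ge0 r; nra.
Qed.

Lemma eq_is_far_field k us us' f :
  near_infinity (fun x => us' x = us x) ->
  is_far_field k us f -> is_far_field k us' f.
Proof.
move=> e [c Hf]; exists c; have [r H] := near_infinity_and e Hf.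
by exists r => x /H[-> ].
Qed.

Lemma is_far_field_rotation k phi us f : is_far_field k us f ->
  is_far_field k (fun x => us (rotation phi x)) (fun x => f (rotation phi x)).
Proof.
move=> [c /(near_infinity_rotation phi)[r H]]; exists c, r => x /H.
by rewrite enorm_rotation unit_vec_rotation.
Qed.

Lemma circle_rotation phi x : circle x -> circle (rotation phi x).
Proof. by rewrite /circle /= enorm_rotation. Qed.

Lemma scattered_field_rotation k phi q theta : well_posed k q -> circle theta ->
  near_infinity (fun x => scattered_field k (fun y => q (rotation phi y)) theta x =
    scattered_field k q (rotation phi theta) (rotation phi x)).
Proof.
move=> wp ct; have [u0 [Su0 uniq]] := wp _ (circle_rotation phi ct).
set us := scattered_field k q _; set us' := scattered_field k _ theta.
have Sus : is_scattered_field k q (rotation phi theta) us.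
  by apply: (@xgetPex _ _ [set u | is_scattered_field k q _ u]); exists u0.
have Sus' : is_scattered_field k (fun y => q (rotation phi y)) theta us'.
  apply: (@xgetPex _ _ [set u | is_scattered_field k _ theta u]).
  by exists (fun x => us (rotation phi x)); exact: is_scattered_field_rotation.
(* Uniqueness is available for the contrast [q], so the field chosen for the rotated contrast is
   rotated back; [v] and [us] are then both almost everywhere equal to [u0]. *)
pose v x := us' (rotation (- phi) x).
have Sv : is_scattered_field k q (rotation phi theta) v.
  have := is_scattered_field_rotation (k := k) (phi := - phi)
    (q := fun y => q (rotation phi y)) (theta := rotation phi theta) (us := us').
  rewrite rotationK => /(_ Sus').
  by under [X in is_scattered_field _ X]eq_fun do rewrite rotationNK.
have /(near_infinity_rotation phi)[r H] : near_infinity (fun x => v x = us x).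
  apply: ae_eq_near_infinity; [by have [_ _ []] := Sv|by have [_ _ []] := Sus|].
  apply: negligibleS (negligibleU (uniq _ Sv) (uniq _ Sus)) => x /= hx.
  by rewrite -not_andP => -[vx ux]; apply: hx; rewrite vx ux.
by exists r => x /H; rewrite /v rotationK.
Qed.

(** The pattern chosen for [us'] and the rotated pattern chosen for [us] are both far fields of
    [us'], hence agree on the circle. *)
Lemma far_field_rotation k phi q xhat theta : 0 < k -> well_posed k q ->
  circle theta -> circle xhat ->
  far_field k (fun x => q (rotation phi x)) xhat theta =
  far_field k q (rotation phi xhat) (rotation phi theta).
Proof.
move=> k0 wp ct cx; have near_eq := scattered_field_rotation phi wp ct.
rewrite /far_field.
set us' := scattered_field k _ theta in near_eq *.
set us := scattered_field k q _ in near_eq *.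
have fwd f : is_far_field k us' f ->
    is_far_field k us (fun x => f (rotation (- phi) x)).
  move=> /(is_far_field_rotation (- phi)); apply: eq_is_far_field.
  have [r H] := near_infinity_rotation (- phi) near_eq.
  by exists r => x /H; rewrite rotationNK.
have bwd f : is_far_field k us f ->
    is_far_field k us' (fun x => f (rotation phi x)).
  by move=> /(is_far_field_rotation phi); exact: eq_is_far_field.
have [[f ff]|nof] := pselect (exists f, is_far_field k us f).
  have H := @xgetPex _ (fun=> 0 : R[i]) [set f | is_far_field k us f] (ex_intro _ f ff).
  have H' := @xgetPex _ (fun=> 0 : R[i]) [set f | is_far_field k us' f]
    (ex_intro _ _ (bwd _ ff)).
  exact: (far_field_unique k0 H' (bwd _ H) cx).
(* Without a far field for [us] there is none for [us'] either, by [fwd], and both choices fall back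
   to the default zero function. *)
have N' := @xgetPN _ (fun=> 0 : R[i]) [set f | is_far_field k us' f]
  (fun f Hf => nof (ex_intro _ _ (fwd f Hf))).
have N := @xgetPN _ (fun=> 0 : R[i]) [set f | is_far_field k us f]
  (fun f Hf => nof (ex_intro _ f Hf)).
by apply: etrans (congr1 (fun f => f xhat) N') (esym (congr1 (fun f => f _) N)).
Qed.

Lemma data_operator_rotation k phi q p : 0 < k -> well_posed k q ->
  data_operator k (fun x => q (rotation phi x)) p =
  data_operator k q (rotation phi p).
Proof.
(* Equality of the two sets of candidate values suffices, since [xget] depends on the set alone. *)
move=> k0 wp; apply: (congr1 (xget 0)).
apply/seteqP; split=> w [p0 [xhat [theta [cx ct pE ->]]]]; split.
- by move=> h; apply: p0; rewrite -(rotationK phi p) h /rotation !mulr0 subr0 addr0.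
- exists (rotation phi xhat), (rotation phi theta); split.
  + exact: circle_rotation.
  + exact: circle_rotation.
  + by rewrite pE rotation_scale rotation_add rotation_opp.
  + by rewrite far_field_rotation.
- by move=> h; apply: p0; rewrite h /rotation !mulr0 subr0 addr0.
- exists (rotation (- phi) xhat), (rotation (- phi) theta); split.
  + exact: circle_rotation.
  + exact: circle_rotation.
  + by rewrite -(rotationK phi p) pE rotation_scale rotation_add rotation_opp.
  + by rewrite far_field_rotation ?rotationNK//; exact: circle_rotation.
Qed.

End FarField.

Unset Implicit Arguments.
Set Strict Implicit.
Set Printing Implicit Defensive.

Theorem theorem3p2 (R : realType) (k : R) (phi : R) (q : plane R -> R[i])
  (k_gt0 : 0 < k) (phi_ge0 : 0 <= phi) (phi_le : phi <= 2 * pi)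
  (q_Linfty : cLp +oo%E (@unit_disk R) q)
  (q_wp : well_posed k q) :
  {ae lebesgue2 R, forall p, unit_disk p ->
     data_operator k (rotf phi q) p = rotf phi (data_operator k q) p}.
(* As [rotf phi] composes with [rotation (- phi)], the lemma is applied at the angle [- phi]; it
   gives the equality at every point. *)
Proof. by apply: aeW => p _; exact: data_operator_rotation. Qed.
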